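(* For given positive integers $l, m$ and $2\leq p\leq q$ ($p,q$ integers), there is a graph $G$ which contains a copy of the complete bipartite graph $\mathcal{K}_{l,m}$, and whose chromatic number, clique number, and Lovász bound are $q$, $p$, and $3$, respectively; that is, $\chi(G)=q$, $\omega(G)=p$, and $\mathrm{conn}(||\mathcal{N}(G)||)+3=3$.
   Context: The chromatic number $\chi(G)$ is the smallest number of colors needed to color the vertices of $G$ so that no two adjacent vertices share the same color. The clique number $\omega(G)$ is the largest number of vertices in a complete subgraph of $G$. A copy of $\mathcal{K}_{l,m}$ in $G$ is a (not necessarily induced) subgraph isomorphic to $\mathcal{K}_{l,m}$. The neighborhood complex $\mathcal{N}(G)$ of a graph $G$ is the simplicial complex whose simplices are all subsets of vertices of $G$ which have a common neighbor in $G$; $||\mathcal{N}(G)||$ denotes its geometric realization. A topological space $X$ is $k$-connected if for every $-1\leq j\leq k$, each continuous map from the $j$-dimensional sphere $\mathbb{S}^j$ to $X$ extends to a continuous map from the $(j+1)$-dimensional ball $\mathbb{B}^{j+1}$ to $X$, where $\mathbb{S}^{-1}=\emptyset$ and $\mathbb{B}^{0}$ is a single point; thus $(-1)$-connected means nonempty. In other words, a nonempty space $X$ is $k$-connected if the homotopy groups $\pi_i(X)$ are trivial for all $i=0,\dots,k$. The largest $k$ such that $X$ is $k$-connected is denoted $\mathrm{conn}(X)$. A simplicial complex is $k$-connected if its geometric realization is. Lovász's theorem says that if $\mathcal{N}(G)$ is $k$-connected, then $\chi(G)\geq k+3$. The Lovász bound of $G$ is the resulting number $\mathrm{conn}(|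|\mathcal{N}(G)||)+3$.
   Formalization: The case p = q = 2 is excluded (q > 2 is assumed): there the claim is false, since a graph with chromatic number 2 is bipartite with an edge, so its neighborhood complex is nonempty and disconnected and its Lovász bound is 2, not 3. *)

(* Defs.v *)
From HB Require Import structures.
From mathcomp Require Import all_boot all_order all_algebra.
From mathcomp Require Import all_classical all_reals all_analysis.
Import Order.TTheory GRing.Theory Num.Theory.
Import numFieldNormedType.Exports.

Set Implicit Arguments.
Unset Strict Implicit.
Unset Printing Implicit Defensive.

Local Open Scope classical_set_scope.
Local Open Scope ring_scope.

Record sgraph := SGraph {
  vertex :> finType;
  adj : rel vertex;
  adj_sym : symmetric adj;
  adj_irr : irreflexive adj }.

Definition colorable (G : sgraph) (k : nat) : bool :=
  [exists f : {ffun G -> 'I_k},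
     [forall x, forall y, adj x y ==> (f x != f y)]].

Lemma ex_colorable (G : sgraph) : exists k, colorable G k.
Proof.
exists #|G|; apply/existsP; exists [ffun x => enum_rank x].
apply/forallP => x; apply/forallP => y; apply/implyP => xy.
rewrite !ffunE; apply/eqP => /enum_rank_inj xy_eq.
by move: xy; rewrite xy_eq adj_irr.
Qed.

Definition chromatic_number (G : sgraph) : nat := ex_minn (ex_colorable G).

Definition clique (G : sgraph) (A : {set G}) : bool :=
  [forall x in A, forall y in A, (x != y) ==> adj x y].

Definition clique_number (G : sgraph) : nat :=
  (\max_(A : {set G} | clique A) #|A|)%N.

Definition Kbip_adj (l m : nat) : rel ('I_l + 'I_m) :=
  fun u v => match u, v with
             | inl _, inr _ | inr _, inl _ => true
             | _, _ => false
             end.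

Lemma Kbip_sym (l m : nat) : symmetric (@Kbip_adj l m).
Proof. by move=> [i|i] [j|j]. Qed.

Lemma Kbip_irr (l m : nat) : irreflexive (@Kbip_adj l m).
Proof. by move=> [i|i]. Qed.

Definition Kbip (l m : nat) : sgraph := SGraph (@Kbip_sym l m) (@Kbip_irr l m).

(* Copies need not be induced: only edges, not non-edges, are preserved. *)
Definition contains_copy (G H : sgraph) : Prop :=
  exists f : H -> G,
    injective f /\ (forall x y, adj x y -> adj (f x) (f y)).

(* A simplicial complex on a finite vertex set is given by its family of
   faces; the empty face and vertices lying in no face do not affect the
   realization below. *)
Definition neighborhood_complex (G : sgraph) : {set {set G}} :=
  [set A : {set G} | [exists v, forall x in A, adj v x]].

(* Barycentric coordinates, as a subset of R^T with the product topology. *)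
Definition realization (R : realType) (T : finType) (K : {set {set T}}) :
    set {ptws T -> R} :=
  [set x | [/\ forall v, 0 <= x v,
               \sum_v x v = 1 &
               [set v | x v != 0]%SET \in K]].
Arguments realization R {T} K.

(* The sphere of dimension n - 1 and the ball of dimension n, for the Euclidean
   norm (`|x| on 'rV[R]_n is the sup norm). For n = 0 these are the empty set
   and a point. *)
Definition sphere (R : realType) (n : nat) : set 'rV[R]_n :=
  [set x | \sum_i x ord0 i ^+ 2 = 1].
Arguments sphere : clear implicits.

Definition eball (R : realType) (n : nat) : set 'rV[R]_n :=
  [set x | \sum_i x ord0 i ^+ 2 <= 1].
Arguments eball : clear implicits.

(* The sphere of dimension j is [sphere R n] with j = n - 1, so that
   j ranges over -1, ..., k. *)
Definition k_connected (R : realType) (X : topologicalType) (k : int) : Prop :=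
  forall n : nat, n%:Z - 1 <= k ->
  forall f : sphere R n -> X, continuous f ->
  exists g : eball R n -> X,
    continuous g /\
    forall (s : sphere R n) (b : eball R n), \val b = \val s -> g b = f s.
Arguments k_connected : clear implicits.

(* conn(X) = k. A relation, since there is no largest k when X is k-connected
   for all k. *)
Definition is_conn (R : realType) (X : topologicalType) (k : int) : Prop :=
  k_connected R X k /\ forall k', k_connected R X k' -> k' <= k.
Arguments is_conn : clear implicits.

Definition is_Lovasz_bound (R : realType) (G : sgraph) (b : int) : Prop :=
  exists2 k : int,
    is_conn R (realization R (neighborhood_complex G)) k & b = k + 3.
Arguments is_Lovasz_bound : clear implicits.

(* Main.v *)
Require Import Defs.
From mathcomp Require Import all_boot all_order all_algebra.
From mathcomp Require Import all_classical all_reals all_analysis.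
From mathcomp Require Import zify ring lra.

(** Let [H] be any graph in which some vertex [y] has two distinct neighbours
    [x] and [z].  Add to [H] one new vertex [w], the hub, and for every vertex
    [u] of [H] a new vertex [u'], the spoke of [u], adjacent to [u] and to [w]
    only.  The resulting [hub_graph H] contains [H], has the same chromatic
    number as soon as that number is at least 3, and has the same clique number
    as soon as that number is at least 2, because a hub or a spoke lies in no
    triangle.  So everything about chromatic and clique number can be arranged
    in [H], while the Lovasz bound of [hub_graph H] is always 3
    ([hub_Lovasz_bound]):

    - The neighbourhood complex is path connected: the spokes form a simplex
      (common neighbour [w]), every old vertex [u] is joined to [w] by the edge
      [N(u') = {w, u}], and the simplex [N(x)], which contains both the spoke
      [x'] and the old vertex [y], links the two parts.

    - It is not simply connected.  The edge [{w, x}] lies in no larger simplex,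
      since [x'] is the only common neighbour of [w] and [x], and it belongs to
      the closed curve [w - x - z - w], whose edge [{x, z}] comes from the
      common neighbour [y].  This curve crosses the midpoint of the free edge
      [{w, x}] exactly once, whereas the signed number of crossings is a
      homotopy invariant which vanishes for a contractible curve
      ([triangle_loop_not_null]).

    For the second point no degree theory is needed.  A filling of the curve by
    a disc gives a homotopy with fixed end points between the two arcs from [w]
    to [x]; on a grid which is so fine that the two barycentric coordinates
    at [w] and [x] vary by less than 1/4 on every cell, the sum of the crossing
    numbers around each cell is zero, so that all rows of the grid have the same
    number of crossings ([crossing_homotopy]).  The first row has one crossing,
    the last row none.

    For [H] we take the disjoint union of three graphs: the complete graph on [p]
    vertices, which realizes the clique number; a complete bipartite graph
    [K_{l+1,m}], where the extra vertex guarantees that [y] has two neighbours;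
    and a shift graph over the subsets of a [q]-element set, which is
    triangle-free and has chromatic number [q] ([colorable_subset_shift],
    [subset_shift_colors]). *)

Import Order.TTheory GRing.Theory Num.Theory.
Import numFieldNormedType.Exports.

Set Implicit Arguments.
Unset Strict Implicit.
Unset Printing Implicit Defensive.

(** * Colourings and cliques *)

Lemma colorableP (G : sgraph) k :
  reflect (exists f : G -> 'I_k, forall x y, adj x y -> f x != f y)
          (colorable G k).
Proof.
apply: (iffP existsP) => [[f /forallP fP]|[f fP]].
  by exists f => x y; move: (fP x) => /forallP/(_ y)/implyP.
exists (finfun f); apply/forallP => x; apply/forallP => y; apply/implyP => xy.
by rewrite !ffunE fP.
Qed.

Lemma colorable_hom (G H : sgraph) (h : H -> G) k :
  (forall x y, adj x y -> adj (h x) (h y)) -> colorable G k -> colorable H k.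
Proof.
by move=> hP /colorableP[f fP]; apply/colorableP; exists (f \o h) => x y /hP/fP.
Qed.

Lemma chromatic_numberE (G : sgraph) k : colorable G k ->
  (forall j, colorable G j -> k <= j) -> chromatic_number G = k.
Proof.
move=> Gk kmin; rewrite /chromatic_number; case: ex_minnP => j Gj jmin.
by apply/eqP; rewrite eqn_leq jmin// kmin.
Qed.

Lemma cliqueP (G : sgraph) (A : {set G}) :
  reflect {in A &, forall x y, x != y -> adj x y} (clique A).
Proof.
apply: (iffP forall_inP) => [AP x y xA yA xy|AP x xA].
  by move: (AP x xA) => /forall_inP/(_ y yA)/implyP/(_ xy).
by apply/forall_inP => y yA; apply/implyP => xy; exact: AP.
Qed.

Lemma clique_numberE (G : sgraph) (A : {set G}) p : clique A -> #|A| = p ->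
  (forall B : {set G}, clique B -> #|B| <= p) -> clique_number G = p.
Proof.
move=> cA Ap Bp; apply/eqP; rewrite eqn_leq; apply/andP; split.
  exact/bigmax_leqP.
by rewrite -Ap; exact: (@leq_bigmax_cond _ (fun B : {set G} => clique B) (fun B => #|B|) A cA).
Qed.

(** A vertex [v] that lies in no triangle lies in no clique of size 3. *)
Lemma clique_le2 (G : sgraph) (A : {set G}) v : clique A -> v \in A ->
  (forall a b, adj v a -> adj v b -> ~~ adj a b) -> #|A| <= 2.
Proof.
move=> /cliqueP cA vA vP; rewrite leqNgt; apply/negP => A3.
have : 1 < #|A :\ v| by move: A3; rewrite (cardsD1 v) vA.
move=> /card_gt1P[a [b []]]; rewrite !inE => /andP[av aA] /andP[bv bA] ab.
have := vP a b; rewrite !cA ?(eq_sym v)//.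
by move=> /(_ isT isT).
Qed.

(** Bounds the cliques of a disjoint union or of a hub graph which stay inside one
    of the pieces; the hypothesis on [f] says that the piece is induced. *)
Lemma clique_in_image (G H : sgraph) (f : H -> G) (A : {set G}) p :
  injective f -> (forall x y, adj (f x) (f y) -> adj x y) ->
  (forall B : {set H}, clique B -> #|B| <= p) ->
  clique A -> (forall v, v \in A -> exists x, v = f x) -> #|A| <= p.
Proof.
move=> finj fadj Hp /cliqueP cA Af.
have -> : A = f @: (f @^-1: A).
  apply/setP => v; apply/idP/imsetP => [vA|[x + ->]]; last by rewrite inE.
  by have [x vE] := Af v vA; exists x; rewrite // inE -vE.
rewrite card_imset//; apply/Hp/cliqueP => x y; rewrite !inE => xA yA xy.
by apply/fadj/cA => //; rewrite (inj_eq finj).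
Qed.

(** * Disjoint unions, complete and complete bipartite graphs *)

Section DisjointUnion.
Variables G H : sgraph.

Definition sum_adj : rel (G + H) := fun u v =>
  match u, v with
  | inl x, inl y => adj x y
  | inr x, inr y => adj x y
  | _, _ => false
  end.

Lemma sum_adj_sym : symmetric sum_adj.
Proof. by move=> [x|x] [y|y] //=; rewrite adj_sym. Qed.

Lemma sum_adj_irr : irreflexive sum_adj.
Proof. by move=> [x|x] /=; rewrite adj_irr. Qed.

Definition disjoint_union : sgraph := SGraph sum_adj_sym sum_adj_irr.

Lemma colorable_disjoint_union k :
  colorable G k -> colorable H k -> colorable disjoint_union k.
Proof.
move=> /colorableP[f fP] /colorableP[g gP]; apply/colorableP.
exists (fun u => match u with inl x => f x | inr x => g x end).
by move=> [x|x] [y|y] //=; [exact: fP|exact: gP].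
Qed.

Lemma clique_disjoint_union p :
  (forall B : {set G}, clique B -> #|B| <= p) ->
  (forall B : {set H}, clique B -> #|B| <= p) ->
  forall A : {set disjoint_union}, clique A -> #|A| <= p.
Proof.
move=> Gp Hp A cA.
have [-> | [[v|v] vA]] := set_0Vmem A; first by rewrite cards0.
- apply: (@clique_in_image disjoint_union G inl) => //; first by move=> ? ? [].
  move=> [x|x] xA; first by exists x.
  by have /cliqueP/(_ _ _ vA xA isT) := cA.
- apply: (@clique_in_image disjoint_union H inr) => //; first by move=> ? ? [].
  move=> [x|x] xA; last by exists x.
  by have /cliqueP/(_ _ _ vA xA isT) := cA.
Qed.

End DisjointUnion.

Definition complete_graph (p : nat) : sgraph.
Proof.
by refine (@SGraph 'I_p (fun i j => i != j) _ _) => [i j|i];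
  [rewrite eq_sym|rewrite eqxx].
Defined.

Lemma colorable_complete p q : p <= q -> colorable (complete_graph p) q.
Proof.
move=> pq; apply/colorableP; exists (widen_ord pq) => i j /=.
by apply: contraNneq => /(congr1 val)/= ij; exact/eqP/val_inj.
Qed.

Lemma colorable_Kbip l m q : 1 < q -> colorable (Kbip l m) q.
Proof.
move=> q2; apply/colorableP; exists (fun u : Kbip l m =>
  if u is inl _ then Ordinal (ltnW q2) else Ordinal q2).
by move=> [x|x] [y|y].
Qed.

Lemma clique_Kbip l m (A : {set Kbip l m}) : clique A -> #|A| <= 2.
Proof.
move=> cA; have [->|[v vA]] := set_0Vmem A; first by rewrite cards0.
by apply: (clique_le2 cA vA); case: v vA => i _ [a|a] [b|b].
Qed.

(** * Shift graphs *)

Section ShiftGraph.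
Variables (T : finType) (r : T -> nat).

Definition arc := {ab : T * T | r ab.1 < r ab.2}.

Definition arc_adj : rel arc := fun u v =>
  ((val u).2 == (val v).1) || ((val v).2 == (val u).1).

Lemma arc_adj_sym : symmetric arc_adj.
Proof. by move=> u v; rewrite /arc_adj orbC. Qed.

Lemma arc_adj_irr : irreflexive arc_adj.
Proof.
move=> [[a b] /= ab]; rewrite /arc_adj/= orbb.
by apply/eqP => ba; rewrite ba ltnn in ab.
Qed.

Definition shift_graph : sgraph := SGraph arc_adj_sym arc_adj_irr.

(** Three pairwise consecutive arcs either form a directed cycle or, in a suitable
    order [u], [v], [w], satisfy that [v] follows [u] and [w] follows both, so that
    [v] ends where it starts; both contradict that [r] increases along arcs. *)
Lemma clique_shift (A : {set shift_graph}) : clique A -> #|A| <= 2.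
Proof.
move=> cA; have [->|[v vA]] := set_0Vmem A; first by rewrite cards0.
apply: (clique_le2 cA vA) => {vA cA A}.
case: v => [[a b] /= ab] [[c d] /= cd] [[e f] /= ef].
rewrite /arc_adj /= => /orP[]/eqP? /orP[]/eqP?; subst;
  apply/negP => /orP[]/eqP?; subst; lia.
Qed.

(** The sets of colours of the arcs that leave the various points are pairwise
    distinct: the colour of an arc from [a] to [b] is used by an arc leaving [a], but
    by no arc leaving [b], since such an arc is adjacent to it. *)
Lemma shift_colors k : injective r -> colorable shift_graph k -> #|T| <= 2 ^ k.
Proof.
move=> rinj /colorableP[f fP].
pose S a := [set f u | u : shift_graph & (val u).1 == a].
have Sneq a b : r a < r b -> S a != S b.
  move=> ab; pose u : shift_graph := exist _ (a, b) ab.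
  have uS : f u \in S a by apply: imset_f; rewrite inE.
  apply: contraTneq uS => ->; apply/imsetP => -[v]; rewrite inE => /eqP vb fuv.
  by have := fP u v; rewrite fuv eqxx /= /arc_adj /= vb eqxx => /(_ isT).
have Sinj : injective S.
  move=> a b Sab; apply: rinj; apply/eqP.
  by case: ltngtP => // /Sneq; rewrite Sab eqxx.
rewrite -cardsT -(card_imset _ Sinj) (leq_trans (max_card _))//.
by rewrite -cardsT -powersetT card_powerset cardsT card_ord.
Qed.

End ShiftGraph.

Section SubsetShiftGraph.
Variable q : nat.

(** Orders the subsets by cardinality first, so that the order extends inclusion;
    this is what makes [q] colours sufficient below. *)
Definition subset_rank (A : {set 'I_q}) : nat :=
  #|A| * #|{set 'I_q}| + enum_rank A.

Lemma subset_rank_inj : injective subset_rank.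
Proof.
move=> A B /(congr1 (modn^~ #|{set 'I_q}|)).
by rewrite /subset_rank !modnMDl !modn_small// => /val_inj/enum_rank_inj.
Qed.

(** Colour an arc from [A] to [B] with an element of [B] outside [A], which exists
    because [B] comes after [A] in a linear extension of inclusion.  Consecutive
    arcs, from [A] to [B] and from [B] to [C], get an element of [B] and an element
    outside [B]. *)
Lemma colorable_subset_shift : colorable (shift_graph subset_rank) q.
Proof.
have new (u : shift_graph subset_rank) :
    exists c, c \in (val u).2 :\: (val u).1.
  case: u => [[A B] /= AB]; apply/set0Pn; rewrite finset.setD_eq0.
  apply/negP => BA; move: AB; rewrite ltnNge => /negP; apply.
  have [->//|BneqA] := eqVneq B A.
  have : #|B| < #|A| by apply: proper_card; rewrite finset.properEneq BneqA.
  move=> BltA; apply: (@leq_trans (#|B|.+1 * #|{set 'I_q}|)).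
    by rewrite /subset_rank mulSnr leq_add2l ltnW.
  by apply: leq_trans (leq_addr _ _); rewrite leq_mul2r BltA orbT.
have [f fP] := fin_all_exists new; apply/colorableP; exists f => u v uv.
apply/eqP => fuv; have := fP u; have := fP v; rewrite fuv !inE.
move=> /andP[v1 v2] /andP[u1 u2].
by case/orP: uv => /eqP e; [rewrite -e u2 in v1|rewrite -e v2 in u1].
Qed.

Lemma subset_shift_colors k : colorable (shift_graph subset_rank) k -> q <= k.
Proof.
move=> /(shift_colors subset_rank_inj).
by rewrite -cardsT -powersetT card_powerset cardsT card_ord leq_exp2l.
Qed.

End SubsetShiftGraph.

(** * Attaching a hub *)

Section Hub.
Variable H : sgraph.

Definition hub_adj : rel (option (H + H)) := fun u v =>
  match u, v with
  | Some (inl x), Some (inl y) => adj x y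
  | Some (inl x), Some (inr y) | Some (inr x), Some (inl y) => x == y
  | None, Some (inr _) | Some (inr _), None => true
  | _, _ => false
  end.

Lemma hub_adj_sym : symmetric hub_adj.
Proof. by move=> [[x|x]|] [[y|y]|] //=; [rewrite adj_sym|rewrite eq_sym..]. Qed.

Lemma hub_adj_irr : irreflexive hub_adj.
Proof. by move=> [[x|x]|] //=; rewrite adj_irr. Qed.

Definition hub_graph : sgraph := SGraph hub_adj_sym hub_adj_irr.

Definition hub : hub_graph := None.
Definition old (x : H) : hub_graph := Some (inl x).
Definition spoke (x : H) : hub_graph := Some (inr x).

(** The third colour is for a spoke, whose two neighbours may have different
    colours. *)
Lemma colorable_hub k : 2 < k -> colorable H k -> colorable hub_graph k.
Proof.
move=> k3 /colorableP[f fP].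
pose c0 := Ordinal (ltnW (ltnW k3)).
have third x : exists c : 'I_k, c \notin [set c0; f x].
  apply/existsP; rewrite -negb_forall; apply/forallP => h.
  have : [set: 'I_k]%SET \subset [set c0; f x].
    by apply/fintype.subsetP => c _; exact: h.
  move=> /subset_leq_card; rewrite cardsT card_ord cards2; case: eqP; lia.
have [g gP] := fin_all_exists third; apply/colorableP.
exists (fun u : hub_graph =>
  match u with Some (inl x) => f x | Some (inr x) => g x | None => c0 end).
have gP' x : (g x != c0) /\ (g x != f x).
  by apply/andP; move: (gP x); rewrite !inE negb_or.
move=> [[x|x]|] [[y|y]|] //=.
- exact: fP.
- by move=> /eqP<-; rewrite eq_sym; have [] := gP' x.
- by move=> /eqP<-; have [] := gP' x.
- by have [] := gP' x.
- by rewrite eq_sym; have [] := gP' y.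
Qed.

Lemma clique_hub p : 2 <= p -> (forall B : {set H}, clique B -> #|B| <= p) ->
  forall A : {set hub_graph}, clique A -> #|A| <= p.
Proof.
move=> p2 Hp A cA.
have [hubA|hubA] := boolP (hub \in A).
  by apply: leq_trans p2; apply: (clique_le2 cA hubA) => -[[a|a]|] [[b|b]|].
have [[x xA]|nospoke] := pselect (exists x, spoke x \in A).
  apply: leq_trans p2; apply: (clique_le2 cA xA) => -[[a|a]|] [[b|b]|] //=.
  by move=> /eqP<- /eqP<-; rewrite adj_irr.
apply: (@clique_in_image hub_graph H old) => //; first by move=> ? ? [].
move=> [[x|x]|] vA; [by exists x| |by rewrite vA in hubA].
by case: nospoke; exists x.
Qed.

Local Notation NG := (neighborhood_complex hub_graph).

(** The spoke of [x] is the only common neighbour of the hub and [x]. *)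
Lemma hub_facet x (A : {set hub_graph}) : A \in NG ->
  hub \in A -> old x \in A -> A \subset [set hub; old x].
Proof.
rewrite inE => /existsP[v /forall_inP vP] hubA xA.
have := vP _ hubA; case: v vP => [[y|y]|] vP //= _.
have /eqP yx : y == x := vP _ xA.
apply/fintype.subsetP => -[[a|a]|] aA; rewrite !inE//.
  by have /eqP <- : y == a := vP _ aA; rewrite yx eqxx.
by have := vP _ aA.
Qed.

Lemma common_neighbor (G : sgraph) (a b v : G) :
  adj v a -> adj v b -> [set a; b] \in neighborhood_complex G.
Proof.
move=> va vb; rewrite inE; apply/existsP; exists v.
by apply/forall_inP => c; rewrite !inE => /orP[]/eqP->.
Qed.

(** Old vertices are linked to the hub through their spokes.  Spokes are linked to
    each other through the hub, and the one at [x0] is linked to the old vertex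
    [y0] through [x0]. *)
Lemma hub_connect x0 y0 : @adj H x0 y0 -> forall v : hub_graph,
  connect [rel a b | [set a; b] \in NG] v hub.
Proof.
move=> xy0.
have old_hub x : connect [rel a b | [set a; b] \in NG] (old x) hub.
  by apply: connect1; apply: (@common_neighbor hub_graph _ _ (spoke x)) => /=.
move=> [[x|x]|]; [exact: old_hub| |exact: connect0].
apply: (connect_trans (y := spoke x0)).
  by apply: connect1; apply: (@common_neighbor hub_graph _ _ hub).
apply: connect_trans (old_hub y0); apply: connect1.
by apply: (@common_neighbor hub_graph _ _ (old x0)) => /=.
Qed.

End Hub.

Lemma neighborhood_complex_down (G : sgraph) (A B : {set G}) : A \subset B ->
  B \in neighborhood_complex G -> A \in neighborhood_complex G.
Proof.
move=> /fintype.subsetP AB; rewrite !inE => /existsP[v /forall_inP vB].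
by apply/existsP; exists v; apply/forall_inP => a /AB/vB.
Qed.

Local Open Scope classical_set_scope.
Local Open Scope ring_scope.

(** * Points of a realization, and continuity *)

Definition bary (R : realType) (T : finType) (K : {set {set T}})
    (p : realization R K) (v : T) : R := \val p v.

Lemma baryP (R : realType) (T : finType) (K : {set {set T}})
  (p : realization R K) : realization R K (bary p).
Proof. exact: set_valP. Qed.

Definition bary_point (R : realType) (T : finType) (K : {set {set T}})
    (x : T -> R) (Kx : realization R K x) : realization R K :=
  exist _ x (mem_set Kx).

Lemma bary_inj (R : realType) (T : finType) (K : {set {set T}})
  (p q : realization R K) : bary p =1 bary q -> p = q.
Proof. by move=> pq; apply/val_inj/funext. Qed.

Lemma bary_continuous (R : realType) (T : finType) (K : {set {set T}}) (v : T) :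
  continuous (fun p : realization R K => bary p v).
Proof.
move=> p.
apply: (@continuous_comp _ _ _
  (@set_val _ (realization R K)) (@proj T (fun=> R) v)).
  exact: initial_continuous.
exact: proj_continuous.
Qed.

Lemma realization_continuous (R : realType) (T : finType) (K : {set {set T}})
    (X : topologicalType) (f : X -> realization R K) :
  (forall v, continuous (fun t => bary (f t) v)) -> continuous f.
Proof.
move=> fc; apply: continuous_comp_initial => t.
apply/cvg_sup => v; apply/cvg_image.
  by rewrite eqEsubset; split => // y _; exists (fun=> y).
move=> A /(fc v t) /= fA.
exists ((fun x => x v) @^-1` A) => //.
by rewrite image_preimage// eqEsubset; split => // y _; exists (fun=> y).
Qed.

Lemma mx_continuous (R : numFieldType) (X : topologicalType) m n
    (f : X -> 'M[R]_(m, n)) :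
  (forall i j, continuous (fun t => f t i j)) -> continuous f.
Proof.
move=> fc t A [P Pf PA].
apply: (@filterS _ _ _ [set s | forall i j, P i j (f s i j)]).
  by move=> s Ps; apply: PA.
apply: filter_forall => i; apply: filter_forall => j.
exact: fc.
Qed.

Lemma entry_continuous (R : numFieldType) m n (A : set 'M[R]_(m, n)) i j :
  continuous (fun p : A => \val p i j).
Proof.
move=> p.
apply: (@continuous_comp _ _ _ (@set_val _ A) (fun M : 'M[R]_(m, n) => M i j)).
  exact: initial_continuous.
exact: coord_continuous.
Qed.

Lemma set_type_continuous (X Y : topologicalType) (A : set Y) (f : X -> A) :
  continuous (fun t => \val (f t)) -> continuous f.
Proof. exact: continuous_comp_initial. Qed.

Lemma continuous_sub (R : realType) (X : topologicalType) (f g : X -> R) :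
  continuous f -> continuous g -> continuous (fun t => f t - g t).
Proof. by move=> fc gc t; apply: cvgB; [exact: fc|exact: gc]. Qed.

(** Only [p] has to lie in the square, since the cover by balls is taken around
    its points. *)
Lemma unif_continuous_square (R : realType) (f : R * R -> R) (e : R) :
  continuous f -> 0 < e ->
  exists2 d, 0 < d & forall p q : R * R, (`[0, 1] `*` `[0, 1]) p ->
    ball p d q -> `|f p - f q| < e.
Proof.
move=> fc e0.
have /compact_near_coveringP/(_ R (0^'+)
  (fun d p => forall q : R * R, ball p d q -> `|f p - f q| < e)) :
  compact (`[0, 1]%classic `*` `[0, 1]%classic : set (R * R)).
  by apply: compact_setX; exact: segment_compact.
move=> near_cov.
have [|d [d0 dP]] := filter_ex (filterI (nbhs_right_gt 0) (near_cov _ _)).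
  move=> p _.
  have /cvgrPdist_lt/(_ (e / 2)) := fc p.
  rewrite divr_gt0// => /(_ isT) /nbhs_ballP[d /= d0 dP].
  exists (ball p (d / 2), [set r | r < d / 2]) => /=.
    by split; [apply: nbhsx_ballx; rewrite divr_gt0|
               apply: nbhs_right_lt; rewrite divr_gt0].
  move=> [p' r] /= [pp' rd] q p'q.
  have p'd : ball p d p' by apply: le_ball pp'; lra.
  have qd : ball p d q.
    by rewrite (splitr d); apply: ball_triangle pp' _; apply: le_ball p'q; lra.
  have /= := dP _ p'd; have /= := dP _ qd => h1 h2.
  rewrite (_ : f p' - f q = (f p - f q) - (f p - f p')); last by ring.
  by rewrite (le_lt_trans (ler_normB _ _))// (splitr e) ltrD.
by exists d => // p q Sp; exact: dP.
Qed.

(** * Crossings of a free edge *)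

Section Crossing.
Variable R : realType.
Implicit Types u v : R * R.

(** The barycentric coordinates at two vertices spanning an edge that lies in no
    larger simplex: both can be positive only on that edge. *)
Definition edge_coords : set (R * R) :=
  [set u | 0 < u.1 -> 0 < u.2 -> u.1 + u.2 = 1].

Definition mid_edge u : bool := (4^-1 < u.1) && (4^-1 < u.2).

Definition past_middle u : int := if 2^-1 < u.2 then 1 else 0.

(** Counts, with sign, the passages through the midpoint of the edge between two
    nearby positions.  The restriction to [mid_edge] matters: [past_middle] also jumps
    near the middle of other edges at the second vertex, and these jumps must not
    be counted. *)
Definition crossing u v : int :=
  if mid_edge u && mid_edge v then past_middle v - past_middle u else 0.

(** On a small set, crossings are the increments of a function, hence add up to
    zero along closed walks.  If the whole set is in [mid_edge], this function is
    [past_middle].  Otherwise, the set is too close to an end of the edge for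
    its points in [mid_edge] to be on different sides of the midpoint, and there
    are no crossings. *)
Lemma crossing_potential (P : set (R * R)) :
  P `<=` edge_coords ->
  (forall u v, P u -> P v -> `|u.1 - v.1| < 4^-1 /\ `|u.2 - v.2| < 4^-1) ->
  exists h : R * R -> int, forall u v, P u -> P v -> crossing u v = h v - h u.
Proof.
move=> Pedge Psmall.
have [Pmid|] := pselect (forall u, P u -> mid_edge u).
  by exists past_middle => u v Pu Pv; rewrite /crossing !Pmid.
move=> /existsNP[u0 /not_implyP[Pu0 /negP u0N]].
exists (fun=> 0) => u v Pu Pv; rewrite /crossing subr0.
case: ifP => // /andP[/andP[u1 u2] /andP[v1 v2]].
have := Psmall _ _ Pu Pu0; have := Psmall _ _ Pv Pu0.
rewrite !ltr_norml => -[/andP[? ?] /andP[? ?]] [/andP[? ?] /andP[? ?]].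
have eu : u.1 + u.2 = 1 by apply: Pedge => //; lra.
have ev : v.1 + v.2 = 1 by apply: Pedge => //; lra.
rewrite /past_middle; move: u0N; rewrite negb_and -!leNgt => /orP[] ?.
  have -> : 2^-1 < u.2 by lra.
  have -> : 2^-1 < v.2 by lra.
  by rewrite subrr.
have -> : 2^-1 < u.2 = false by lra.
have -> : 2^-1 < v.2 = false by lra.
by rewrite subrr.
Qed.

Lemma crossing_refl u : crossing u u = 0.
Proof. by rewrite /crossing subrr if_same. Qed.

Lemma crossing_on_edge u v : u.1 + u.2 = 1 -> v.1 + v.2 = 1 ->
  `|u.2 - v.2| < 4^-1 -> crossing u v = past_middle v - past_middle u.
Proof.
move=> eu ev; rewrite ltr_norml => /andP[? ?].
rewrite /crossing; case: ifPn => //.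
rewrite /past_middle !negb_and -!leNgt => /orP[/orP[]|/orP[]] ?;
  case: (ltrP 2^-1 u.2) => ?; case: (ltrP 2^-1 v.2) => ? //=;
  by [rewrite subrr|exfalso; lra].
Qed.

(** Discrete Stokes formula on a strip of cells. *)
Lemma row_crossing_eq N (a b : nat -> R * R) :
  crossing (a 0) (b 0) = 0 -> crossing (a N) (b N) = 0 ->
  (forall i, (i < N)%N ->
     crossing (a i) (a i.+1) + crossing (a i.+1) (b i.+1) =
     crossing (a i) (b i) + crossing (b i) (b i.+1)) ->
  \sum_(i < N) crossing (a i) (a i.+1) = \sum_(i < N) crossing (b i) (b i.+1).
Proof.
move=> ab0 abN square.
apply/eqP; rewrite -subr_eq0 -sumrB.
rewrite (eq_bigr (fun i : 'I_N => - (crossing (a i.+1) (b i.+1) -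
                                   crossing (a i) (b i)))).
  by rewrite sumrN -(big_mkord xpredT (fun i => crossing (a i.+1) (b i.+1) -
    crossing (a i) (b i))) telescope_sumr// ab0 abN subr0 oppr0.
by move=> i _; have := square i (ltn_ord i); lia.
Qed.

(** Sampling a homotopy with fixed end points on a fine grid: every row of the grid
    has as many crossings as the next one.  The bound on [N] makes the steps smaller
    than 1/4 for paths of unit speed. *)
Lemma crossing_homotopy (f1 f2 : R * R -> R) :
  continuous f1 -> continuous f2 ->
  (forall p, edge_coords (f1 p, f2 p)) ->
  (forall r s, (f1 (0, r), f2 (0, r)) = (f1 (0, s), f2 (0, s))) ->
  (forall r s, (f1 (1, r), f2 (1, r)) = (f1 (1, s), f2 (1, s))) ->
  exists2 N, (4 < N)%N &
    let row r i := (f1 (i%:R / N%:R, r), f2 (i%:R / N%:R, r)) in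
    \sum_(i < N) crossing (row 0 i) (row 0 i.+1) =
    \sum_(i < N) crossing (row 1 i) (row 1 i.+1).
Proof.
move=> f1c f2c fedge f_0 f_1.
have quarter : 0 < (4^-1 : R) by lra.
have [d1 d10 d1P] := unif_continuous_square f1c quarter.
have [d2 d20 d2P] := unif_continuous_square f2c quarter.
have [N [N4 Nd1 Nd2]] : exists N : nat,
    [/\ (4 < N)%N, N%:R^-1 < d1 & N%:R^-1 < d2].
  exists (5 + Num.bound d1^-1 + Num.bound d2^-1)%N.
  have b1 := archi_boundP (ltW (_ : 0 < d1^-1)).
  have b2 := archi_boundP (ltW (_ : 0 < d2^-1)).
  rewrite !invr_gt0 in b1 b2.
  split; first by lia.
    rewrite invf_plt ?posrE ?ltr0n//.
    by apply: lt_le_trans (b1 d10) _; rewrite ler_nat; lia.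
  rewrite invf_plt ?posrE ?ltr0n//.
  by apply: lt_le_trans (b2 d20) _; rewrite ler_nat; lia.
exists N => //.
have N0 : 0 < N%:R :> R by rewrite ltr0n; lia.
pose t i : R := i%:R / N%:R.
pose u i j := (f1 (t i, t j), f2 (t i, t j)).
have t0 : t 0 = 0 by rewrite /t mul0r.
have tN : t N = 1 by rewrite /t divff// gt_eqF.
have t01 i : (i <= N)%N -> 0 <= t i <= 1.
  by move=> iN; rewrite divr_ge0//= ler_pdivrMr// mul1r ler_nat.
have tstep i k l : (i <= k <= i.+1)%N -> (i <= l <= i.+1)%N ->
    `|t k - t l| <= N%:R^-1.
  move=> ki li; rewrite -mulrBl normrM (@ger0_norm _ N%:R^-1) ?invr_ge0 ?(ltW N0)//.
  rewrite ler_piMl ?invr_ge0 ?(ltW N0)//.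
  have [kl|lk] := leqP k l.
    by rewrite distrC -natrB// ger0_norm ?ler0n// (ler_nat _ _ 1); lia.
  by rewrite -natrB 1?ltnW// ger0_norm ?ler0n// (ler_nat _ _ 1); lia.
have close i j k l k' l' : (i < N)%N -> (j < N)%N ->
    (i <= k <= i.+1)%N -> (j <= l <= j.+1)%N ->
    (i <= k' <= i.+1)%N -> (j <= l' <= j.+1)%N ->
    `|(u k l).1 - (u k' l').1| < 4^-1 /\ `|(u k l).2 - (u k' l').2| < 4^-1.
  move=> iN jN ik jl ik' jl'.
  have Skl : (`[0, 1] `*` `[0, 1])%classic (t k, t l).
    have /andP[_ ki] := ik; have /andP[_ lj] := jl.
    split; rewrite /= in_itv /=; apply: t01.
      exact: leq_trans ki iN.
    exact: leq_trans lj jN.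
  have tk := tstep _ _ _ ik ik'; have tl := tstep _ _ _ jl jl'.
  split.
    by apply: (d1P (t k, t l) (t k', t l')) => //; split => /=;
      rewrite -ball_normE /=; apply: le_lt_trans Nd1.
  by apply: (d2P (t k, t l) (t k', t l')) => //; split => /=;
    rewrite -ball_normE /=; apply: le_lt_trans Nd2.
have row_step j : (j < N)%N ->
    \sum_(i < N) crossing (u i j) (u i.+1 j) =
    \sum_(i < N) crossing (u i j.+1) (u i.+1 j.+1).
  move=> jN; apply: (@row_crossing_eq N (u^~ j) (u^~ j.+1)).
  - by rewrite /u t0 (f_0 (t j.+1) (t j)) crossing_refl.
  - by rewrite /u tN (f_1 (t j.+1) (t j)) crossing_refl.
  - move=> i iN.
    pose P := [set v | exists k l, [/\ (i <= k <= i.+1)%N, (j <= l <= j.+1)%N &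
                                     v = u k l]].
    have [|_ _ [k [l [ik jl ->]]] [k' [l' [ik' jl' ->]]]|h hP] :=
      @crossing_potential P.
    + by move=> _ [k [l [_ _ ->]]]; exact: fedge.
    + exact: close iN jN ik jl ik' jl'.
    + have P1 : P (u i j) by exists i, j; rewrite !leqnn !leqnSn.
      have P2 : P (u i.+1 j) by exists i.+1, j; rewrite !leqnn !leqnSn.
      have P3 : P (u i j.+1) by exists i, j.+1; rewrite !leqnn !leqnSn.
      have P4 : P (u i.+1 j.+1) by exists i.+1, j.+1; rewrite !leqnn !leqnSn.
      rewrite (hP _ _ P1 P2) (hP _ _ P2 P4) (hP _ _ P1 P3) (hP _ _ P3 P4).
      by rewrite addrC subrKA [RHS]addrC subrKA.
have rows j : (j <= N)%N ->
    \sum_(i < N) crossing (u i 0) (u i.+1 0) =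
    \sum_(i < N) crossing (u i j) (u i.+1 j).
  by elim: j => [|j IH jN]; [|rewrite -row_step ?IH ?(ltnW jN)].
by have := rows N (leqnn N); rewrite /u t0 tN.
Qed.

End Crossing.

(** * A homotopy across the disc *)

Section Disc.
Variable R : realType.

(** With [c = sqrt (1 - t)] and [s = sqrt t], the cosine and the sine of an angle
    [a] running from 0 to [pi / 2], this is the straight homotopy from the point of
    angle [a] to the point of angle [- 3 * a]: the triple angle formulas give
    [cos (- 3 a) = c * (1 - 4 * t)] and [sin (- 3 a) = s * (1 - 4 * (1 - t))].
    So it moves the short arc from (1, 0) to (0, 1), along which both
    coordinates are nonnegative, to the long one, along which they are never
    both positive. *)
Definition sweep (t r : R) : 'rV[R]_2 :=
  \row_j (if j == ord0 then Num.sqrt (1 - t) * (1 - 4 * r * t)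
          else Num.sqrt t * (1 - 4 * r * (1 - t))).

Lemma sweep_sqr t r : 0 <= t <= 1 ->
  \sum_i sweep t r ord0 i ^+ 2 = 1 - 16 * (r * (1 - r)) * (t * (1 - t)).
Proof.
move=> /andP[t0 t1]; rewrite big_ord_recl big_ord1 !mxE/= !exprMn !sqr_sqrtr//.
  by ring.
by rewrite subr_ge0.
Qed.

(** Extends maps on the unit interval to the line, in order to have total functions
    on [R] and [R * R]. *)
Definition clamp (t : R) := Num.max 0 (Num.min 1 t).

Lemma clamp01 t : 0 <= clamp t <= 1.
Proof. by rewrite /clamp le_max lexx ge_max ler01 ge_min lexx. Qed.

Lemma clamp_id t : 0 <= t <= 1 -> clamp t = t.
Proof. by move=> /andP[t0 t1]; rewrite /clamp min_r// max_r. Qed.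

Lemma clamp_continuous : continuous clamp.
Proof.
move=> t; apply: continuous_max; first exact: cvg_cst.
by apply: continuous_min; [exact: cvg_cst|exact: cvg_id].
Qed.

Lemma sweep_in_ball t r : eball R 2 (sweep (clamp t) (clamp r)).
Proof.
rewrite /eball /= sweep_sqr ?clamp01// lerBlDr lerDl.
have /andP[? ?] := clamp01 t; have /andP[? ?] := clamp01 r.
by rewrite !mulr_ge0// subr_ge0.
Qed.

Definition disc_sweep (p : R * R) : eball R 2 :=
  exist (fun s => s \in eball R 2) _ (mem_set (sweep_in_ball p.1 p.2)).

Lemma disc_sweep0 r r' : disc_sweep (0, r) = disc_sweep (0, r').
Proof.
apply/val_inj/rowP => j.
rewrite !mxE /= clamp_id ?lexx ?ler01// sqrtr0.
by rewrite !(mulr0, mul0r, subr0).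
Qed.

Lemma disc_sweep1 r r' : disc_sweep (1, r) = disc_sweep (1, r').
Proof.
apply/val_inj/rowP => j.
rewrite !mxE /= clamp_id ?lexx ?ler01// subrr sqrtr0.
by rewrite !(mulr0, mul0r, subr0).
Qed.

Lemma disc_sweep_continuous : continuous disc_sweep.
Proof.
apply: set_type_continuous; apply: mx_continuous => i j.
have c1 : continuous (fun p : R * R => clamp p.1).
  by move=> p; apply: continuous_comp; [exact: cvg_fst|exact: clamp_continuous].
have c2 : continuous (fun p : R * R => clamp p.2).
  by move=> p; apply: continuous_comp; [exact: cvg_snd|exact: clamp_continuous].
have sq (f : R * R -> R) : continuous f -> continuous (fun p => Num.sqrt (f p)).
  by move=> fc p; apply: continuous_comp; [exact: fc|exact: sqrt_continuous].
have c1' : continuous (fun p : R * R => 1 - clamp p.1).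
  by move=> p; apply: cvgB; [exact: cvg_cst|exact: c1].
have -> : (fun p => \val (disc_sweep p) i j) = fun p =>
  if j == ord0 then Num.sqrt (1 - clamp p.1) * (1 - 4 * clamp p.2 * clamp p.1)
  else Num.sqrt (clamp p.1) * (1 - 4 * clamp p.2 * (1 - clamp p.1)).
  by apply/funext => p; rewrite /= mxE.
move=> p; case: eqP => _; (apply: cvgM; first exact: sq);
  (apply: cvgB; [exact: cvg_cst|apply: cvgM; last by [exact: c1|exact: c1']]);
  (apply: cvgM; [exact: cvg_cst|exact: c2]).
Qed.

End Disc.

(** * A closed curve which crosses a free edge once *)

Section Loop.
Variables (R : realType) (T : finType) (K : {set {set T}}) (w x z : T).
Hypotheses (wx : w != x) (xz : x != z) (zw : z != w).
Hypothesis Kdown : forall A B : {set T}, A \subset B -> B \in K -> A \in K.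
Hypotheses (Kwx : [set w; x]%SET \in K) (Kxz : [set x; z]%SET \in K)
  (Kzw : [set z; w]%SET \in K).
Hypothesis wx_facet :
  forall A : {set T}, A \in K -> w \in A -> x \in A -> A \subset [set w; x]%SET.

(** The circle folded onto the triangle [w, x, z]: the first quadrant goes to the edge
    [{w, x}], the second to [{x, z}], the third to the point [z], and the fourth to
    [{z, w}].  Squares make the coordinates sum to 1 on the circle. *)
Definition triangle_loop_coord (s : 'rV[R]_2) (v : T) : R :=
  let a := Num.max 0 (s ord0 ord0) ^+ 2 in
  let b := Num.max 0 (s ord0 ord_max) ^+ 2 in
  if v == w then a else if v == x then b else if v == z then 1 - a - b else 0.

Lemma sum_wxz (y : T -> R) : (forall v, v \notin [:: w; x; z] -> y v = 0) ->
  \sum_v y v = y w + y x + y z.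
Proof.
move=> y0; rewrite (bigD1 w)//= (bigD1 x)/=; last by rewrite eq_sym.
rewrite (bigD1 z)/=; last by rewrite zw eq_sym.
rewrite big1 ?addr0 ?addrA// => v /andP[/andP[vw vx] vz].
by rewrite y0// !inE !negb_or vw vx.
Qed.

Lemma max0_sqr (a : R) : 0 <= Num.max 0 a ^+ 2 <= a ^+ 2.
Proof. by rewrite sqr_ge0 /= maxEle; case: ifPn => // _; rewrite expr0n sqr_ge0. Qed.

Lemma triangle_loop_subproof (s : sphere R 2) :
  realization R K (triangle_loop_coord (\val s)).
Proof.
have := set_valP s; rewrite /sphere /= big_ord_recl big_ord1.
rewrite (_ : lift ord0 ord0 = ord_max); last exact: val_inj.
set a := (\val s ord0 ord0); set b := (\val s ord0 ord_max) => ab1.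
have /andP[a0 a1] := max0_sqr a; have /andP[b0 b1] := max0_sqr b.
have xw : (x == w) = false by rewrite eq_sym (negbTE wx).
have zx : (z == x) = false by rewrite eq_sym (negbTE xz).
split.
- move=> v; rewrite /triangle_loop_coord -/a -/b.
  by do ![case: ifP => _ //]; lra.
- rewrite sum_wxz => [|v].
    by rewrite /triangle_loop_coord !eqxx xw zx (negbTE zw); lra.
  rewrite !inE !negb_or /triangle_loop_coord.
  by move=> /and3P[/negbTE-> /negbTE-> /negbTE->].
- have supp e1 e2 : [set e1; e2]%SET \in K ->
      (forall v, v != e1 -> v != e2 -> triangle_loop_coord (\val s) v = 0) ->
      [set v | triangle_loop_coord (\val s) v != 0]%SET \in K.
    move=> Ke h; apply: Kdown Ke; apply/fintype.subsetP => v; rewrite !inE.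
    by apply: contraR; rewrite negb_or => /andP[? ?]; rewrite h.
  have [a_le0|a_gt0] := lerP a 0.
    apply: (supp _ _ Kxz) => v; rewrite /triangle_loop_coord -/a -/b => /negbTE-> /negbTE->.
    by case: eqP => // _; rewrite max_l// expr0n.
  have [b_le0|b_gt0] := lerP b 0.
    apply: (supp _ _ Kzw) => v; rewrite /triangle_loop_coord -/a -/b => /negbTE-> /negbTE->.
    by case: eqP => // _; rewrite max_l// expr0n.
  apply: (supp _ _ Kwx) => v; rewrite /triangle_loop_coord -/a -/b => /negbTE-> /negbTE->.
  by case: eqP => // _; rewrite !max_r 1?ltW//; lra.
Qed.

Definition triangle_loop (s : sphere R 2) : realization R K :=
  bary_point (triangle_loop_subproof s).

Lemma triangle_loop_coord_continuous v :
  continuous (fun s : 'rV[R]_2 => triangle_loop_coord s v).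
Proof.
have cm i : continuous (fun s : 'rV[R]_2 => Num.max 0 (s ord0 i) ^+ 2).
  have max_continuous : continuous (fun a : R => Num.max 0 a).
    by move=> a; apply: continuous_max; [exact: cvg_cst|exact: cvg_id].
  have max_sqr_continuous : continuous (fun a : R => Num.max 0 a ^+ 2).
    by move=> a; apply: cvgM; exact: max_continuous.
  move=> s; apply: (@continuous_comp _ _ _ (fun s : 'rV[R]_2 =>
    s ord0 i) (fun a => Num.max 0 a ^+ 2)); first exact: coord_continuous.
  exact: max_sqr_continuous.
rewrite /triangle_loop_coord => s.
case: (v == w); first exact: cm.
case: (v == x); first exact: cm.
case: (v == z); last exact: cst_continuous.
apply: (continuous_sub _ (cm ord_max)).
apply: (continuous_sub _ (cm ord0)).
exact: cst_continuous.
Qed.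

Lemma triangle_loop_continuous : continuous triangle_loop.
Proof.
apply: realization_continuous => v s.
apply: (@continuous_comp _ _ _ (@set_val _ (sphere R 2))
  (triangle_loop_coord^~ v)); first exact: initial_continuous.
exact: triangle_loop_coord_continuous.
Qed.

Definition wx_coords (p : realization R K) : R * R := (bary p w, bary p x).

Lemma wx_coords_edge p : edge_coords (wx_coords p).
Proof.
rewrite /edge_coords /= => pw px; have [p0 p1 Kp] := baryP p.
have sub : [set v | bary p v != 0]%SET \subset [set w; x]%SET.
  by apply: wx_facet Kp _ _; rewrite inE gt_eqF.
rewrite -p1 sum_wxz => [|v vwxz].
  suff -> : bary p z = 0 by rewrite addr0.
  apply/eqP; apply: contraLR xz => pz; move/fintype.subsetP: sub => /(_ z).
  by rewrite !inE pz (negbTE zw) => /(_ isT) /eqP->; rewrite eqxx.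
apply/eqP; apply: contraNT vwxz => pv; move/fintype.subsetP: sub => /(_ v).
by rewrite !inE pv => /(_ isT) /orP[]->; rewrite ?orbT.
Qed.

(** Transported by [disc_sweep], an extension to the disc would be a homotopy with fixed
    end points between an arc crossing the midpoint of [{w, x}] once and an
    arc which never meets the interior of this edge. *)
Lemma triangle_loop_not_null (g : eball R 2 -> realization R K) :
  continuous g ->
  ~ forall (s : sphere R 2) (b : eball R 2), \val b = \val s ->
      g b = triangle_loop s.
Proof.
move=> gc gf.
pose c v (p : R * R) := bary (g (disc_sweep p)) v.
have cc v : continuous (c v).
  have gsc : continuous (g \o disc_sweep (R := R)).
    by move=> p; apply: continuous_comp; [exact: disc_sweep_continuous|exact: gc].
  move=> p; apply: (@continuous_comp _ _ _ (g \o disc_sweep (R := R))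
    (fun q => bary q v)); first exact: gsc.
  exact: bary_continuous.
have [||N N4 /=] := crossing_homotopy (cc w) (cc x)
  (fun p => @wx_coords_edge (g (disc_sweep p))).
- by move=> r s; rewrite /c (disc_sweep0 r s).
- by move=> r s; rewrite /c (disc_sweep1 r s).
have N0 : 0 < N%:R :> R by rewrite ltr0n; exact: leq_trans N4.
pose t i : R := i%:R / N%:R.
have tN : t N = 1 by rewrite /t divff// gt_eqF.
have t01 i : (i <= N)%N -> 0 <= t i <= 1.
  by move=> iN; rewrite divr_ge0//= ler_pdivrMr// mul1r ler_nat.
have tS i : t i.+1 - t i = N%:R^-1.
  by rewrite /t -mulrBl -natr1 addrC addKr mul1r.
have on_sphere i r : (i <= N)%N -> r = 0 \/ r = 1 ->
    (c w (t i, r), c x (t i, r)) = (Num.max 0 (sweep (t i) r ord0 ord0) ^+ 2,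
             Num.max 0 (sweep (t i) r ord0 ord_max) ^+ 2).
  move=> iN r01; have ti := t01 _ iN.
  have rI : 0 <= r <= 1 by case: r01 => ->; rewrite lexx ler01.
  have Ss : sphere R 2 (sweep (t i) r).
    by rewrite /sphere /= sweep_sqr//; case: r01 => ->; ring.
  rewrite /c (gf (exist (fun s => s \in sphere R 2) _ (mem_set Ss))).
    rewrite /bary /= /triangle_loop_coord !eqxx.
    by rewrite [x == w]eq_sym (negbTE wx).
  by rewrite /= !clamp_id.
have u0 i : (i <= N)%N -> (c w (t i, 0), c x (t i, 0)) = (1 - t i, t i).
  move=> iN; have /andP[? ?] := t01 _ iN.
  rewrite on_sphere//; last by left.
  rewrite !mxE/= !(mulr0, mul0r, subr0, mulr1).
  by rewrite !max_r ?sqrtr_ge0// !sqr_sqrtr// subr_ge0.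
have uN i : (i <= N)%N -> mid_edge (c w (t i, 1), c x (t i, 1)) = false.
  move=> iN; have /andP[ti0 ti1] := t01 _ iN.
  rewrite on_sphere//; last by right.
  rewrite !mxE/=; apply/negP => /andP[/=].
  have pos (a b : R) : 0 <= a -> 4^-1 < Num.max 0 (a * b) ^+ 2 -> 0 < b.
    move=> a0; have [|b0 _] := lerP (a * b) 0.
      by rewrite expr0n/=; lra.
    by rewrite ltNge; apply/negP => b_le0; have := mulr_ge0_le0 a0 b_le0; lra.
  (* Both coordinates positive would give t < 1/4 and t > 3/4. *)
  move=> /(pos _ _ (sqrtr_ge0 _)) ? /(pos _ _ (sqrtr_ge0 _)) ?.
  lra.
rewrite [RHS]big1 => [|i _]; last by rewrite /crossing uN// ltnW.
pose pm i := past_middle (c w (t i, 0), c x (t i, 0)).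
rewrite (eq_bigr (fun i : 'I_N => pm i.+1 - pm i)) => [|i _].
  rewrite -(big_mkord xpredT (fun i => pm i.+1 - pm i)) telescope_sumr//.
  rewrite /pm !u0// /past_middle tN /t mul0r/=.
  have -> : 2^-1 < 1 :> R by lra.
  by have -> : 2^-1 < 0 :> R = false by lra.
have iN := ltn_ord i.
rewrite crossing_on_edge -/(t i) -/(t i.+1)// !u0 ?(ltnW iN)//= ?subrK//.
rewrite distrC tS ger0_norm ?invr_ge0 ?(ltW N0)//.
by rewrite ltf_pV2 ?posrE// (ltr_nat _ 4).
Qed.

End Loop.

(** * Path connectedness of realizations *)

Section PathConnected.
Variables (R : realType) (T : finType) (K : {set {set T}}).
Hypothesis Kdown : forall A B : {set T}, A \subset B -> B \in K -> A \in K.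

Definition joined (p q : realization R K) :=
  exists c : R -> realization R K, [/\ continuous c, c 0 = p & c 1 = q].

Lemma joined_sym p q : joined p q -> joined q p.
Proof.
move=> [c [cc c0 c1]]; exists (fun t => c (1 - t)); split.
- move=> t; apply: (@continuous_comp _ _ _ (fun t : R => 1 - t) c); last exact: cc.
  by apply: cvgB; [exact: cvg_cst|exact: cvg_id].
- by rewrite subr0.
- by rewrite subrr.
Qed.

Lemma joined_trans q p r : joined p q -> joined q r -> joined p r.
Proof.
move=> [a [ac a0 a1]] [b [bc b0 b1]].
(* At each time, one of the two paths rests at [q], so that this sum is a
   concatenation whose coordinates are continuous without gluing. *)
pose y t v := bary (a (clamp (2 * t))) v + bary (b (clamp (2 * t - 1))) v
  - bary q v.
have yE t : y t = bary (a (clamp (2 * t))) \/ y t = bary (b (clamp (2 * t - 1))).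
  have [t_le|t_gt] := lerP t 2^-1; [left|right]; apply/funext => v; rewrite /y.
    have -> : clamp (2 * t - 1) = 0.
      by rewrite /clamp min_r; [rewrite max_l//|]; lra.
    by rewrite b0 addrK.
  have -> : clamp (2 * t) = 1 by rewrite /clamp min_l; [rewrite max_r|]; lra.
  by rewrite a1 addrAC subrr add0r.
have Ky t : realization R K (y t) by case: (yE t) => ->; exact: baryP.
exists (fun t => bary_point (Ky t)); split.
- apply: realization_continuous => v.
  have comp (f : R -> realization R K) (h : R -> R) : continuous f ->
      continuous h -> continuous (fun t => bary (f (clamp (h t))) v).
    move=> fc hc t; apply: (@continuous_comp _ _ _ (fun t => f (clamp (h t)))
      (fun q => bary q v)); last exact: bary_continuous.
    apply: (@continuous_comp _ _ _ (fun t => clamp (h t)) f); last exact: fc.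
    apply: (@continuous_comp _ _ _ h (@clamp R)); last exact: clamp_continuous.
    exact: hc.
  have double : continuous (fun t : R => 2 * t).
    by move=> t; apply: cvgM; [exact: cvg_cst|exact: cvg_id].
  move=> t; apply: cvgB; last exact: cvg_cst.
  apply: cvgD; apply: comp => //.
  by move=> {}t; apply: cvgB; [exact: double|exact: cvg_cst].
- apply: bary_inj => v; rewrite /bary/= /y mulr0 sub0r.
  rewrite /clamp !min_r ?max_l; try lra.
  by rewrite a0 b0 addrK.
- apply: bary_inj => v; rewrite /bary/= /y mulr1.
  rewrite (_ : clamp 2 = 1) ?a1; last by rewrite /clamp min_l ?max_r//; lra.
  rewrite (_ : clamp (2 - 1) = 1) ?b1; last by rewrite /clamp min_l ?max_r//; lra.
  by rewrite addrAC subrr add0r.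
Qed.

(** The segment from [p] to [q] stays inside the simplex [A]. *)
Lemma joined_in_face p q (A : {set T}) : A \in K ->
  (forall v, v \notin A -> bary p v = 0) ->
  (forall v, v \notin A -> bary q v = 0) -> joined p q.
Proof.
move=> AK pA qA.
pose y t v := bary p v + clamp t * (bary q v - bary p v).
have [p0 p1 _] := baryP p; have [q0 q1 _] := baryP q.
have Ky t : realization R K (y t).
  have /andP[t0 t1] := clamp01 t; split.
  - move=> v; have := p0 v; have := q0 v; rewrite /y; nra.
  - by rewrite big_split/= -mulr_sumr sumrB p1 q1 subrr mulr0 addr0.
  - apply: Kdown AK; apply/fintype.subsetP => v; rewrite inE.
    by apply: contraR => vA; rewrite /y pA// qA// subrr mulr0 addr0.
exists (fun t => bary_point (Ky t)); split.
- apply: realization_continuous => v t.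
  apply: cvgD; first exact: cvg_cst.
  by apply: cvgM; [exact: clamp_continuous|exact: cvg_cst].
- by apply: bary_inj => v; rewrite {1}/bary/= /y clamp_id ?lexx ?ler01// mul0r addr0.
- by apply: bary_inj => v; rewrite {1}/bary/= /y clamp_id ?lexx ?ler01// mul1r subrKC.
Qed.

Lemma vertex_subproof u : [set u]%SET \in K ->
  realization R K (fun v => (v == u)%:R).
Proof.
move=> Ku; split.
- by move=> v; rewrite ler0n.
- rewrite (bigD1 u)//= eqxx big1 ?addr0// => v /negbTE->//.
- by apply: Kdown Ku; apply/fintype.subsetP => v; rewrite !inE; case: (v =P u) => // _; rewrite eqxx.
Qed.

Definition vertex_point u (Ku : [set u]%SET \in K) : realization R K :=
  bary_point (vertex_subproof Ku).

Lemma joined_vertices u v (Ku : [set u]%SET \in K) (Kv : [set v]%SET \in K) :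
  connect [rel a b | [set a; b]%SET \in K] u v ->
  joined (vertex_point Ku) (vertex_point Kv).
Proof.
move=> /connectP[s]; elim: s u Ku => [|a s IH] u Ku /=.
  move=> _ vu; apply: (joined_in_face Ku) => b; rewrite inE => /negbTE bu.
    by rewrite /bary/= bu.
  by rewrite /bary/= vu bu.
move=> /andP[Kua pth] vlast.
have Ka : [set a]%SET \in K by apply: Kdown Kua; rewrite finset.sub1set !inE eqxx orbT.
apply: joined_trans (IH _ Ka pth vlast).
apply: (joined_in_face Kua) => b; rewrite !inE negb_or => /andP[/negbTE bu /negbTE ba].
  by rewrite /bary/= bu.
by rewrite /bary/= ba.
Qed.

Lemma joined_to_vertex (p : realization R K) :
  exists u (Ku : [set u]%SET \in K), joined p (vertex_point Ku).
Proof.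
have [p0 p1 Kp] := baryP p.
have [u pu] : exists u, bary p u != 0.
  apply: contrapT => /forallNP pN; have /eqP := p1; rewrite big1 => [|v _].
    by rewrite eq_sym oner_eq0.
  by apply/eqP/negP => /negP; exact: pN.
have Ku : [set u]%SET \in K by apply: Kdown Kp; rewrite finset.sub1set inE.
exists u, Ku; apply: (joined_in_face Kp) => v; rewrite inE negbK => /eqP//.
by move=> pv; rewrite /bary/=; case: eqP => // vu; rewrite -vu pv eqxx in pu.
Qed.

(** Every point is joined to a vertex of its supporting simplex, and from there to [w]
    along edges. *)
Lemma realization_0_connected w : [set w]%SET \in K ->
  (forall v, [set v]%SET \in K -> connect [rel a b | [set a; b]%SET \in K] v w) ->
  k_connected R (realization R K) 0.
Proof.
move=> Kw Kconn.
have joined_w p : joined p (vertex_point Kw).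
  have [u [Ku pu]] := joined_to_vertex p.
  exact: joined_trans pu (joined_vertices _ _ (Kconn _ Ku)).
move=> [|[|n]] n_le1 f fc; last by exfalso; lia.
  exists (fun=> vertex_point Kw); split; first exact: cst_continuous.
  by move=> s; have := set_valP s; rewrite /sphere /= big_ord0 => /eqP;
    rewrite eq_sym oner_eq0.
have sphere1 (e : R) : e ^+ 2 = 1 -> sphere R 1 (\row_(i < 1) e).
  by rewrite /sphere /= big_ord1 mxE.
pose pole e (e1 : e ^+ 2 = 1) : sphere R 1 :=
  exist (fun s => s \in sphere R 1) _ (mem_set (sphere1 e e1)).
have sqrN1 : (-1) ^+ 2 = 1 :> R by rewrite sqrrN expr1n.
have sqr1 : 1 ^+ 2 = 1 :> R by rewrite expr1n.
have [c [cc c0 c1]] :=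
  joined_trans (joined_w (f (pole _ sqrN1))) (joined_sym (joined_w (f (pole _ sqr1)))).
exists (fun b : eball R 1 => c ((\val b ord0 ord0 + 1) / 2)); split.
  have half : continuous (fun r : R => (r + 1) / 2).
    move=> r; apply: cvgM; last exact: cvg_cst.
    by apply: cvgD; [exact: cvg_id|exact: cvg_cst].
  move=> b; apply: (@continuous_comp _ _ _
    (fun b : eball R 1 => (\val b ord0 ord0 + 1) / 2) c); last exact: cc.
  apply: (@continuous_comp _ _ _ (fun b : eball R 1 => \val b ord0 ord0)
    (fun r => (r + 1) / 2)); [exact: entry_continuous|exact: half].
move=> s b ->; have := set_valP s; rewrite /sphere /= big_ord1.
move=> /eqP; rewrite sqrf_eq1 => /orP[] /eqP se; rewrite se.
  rewrite -[1 + 1]/(2%:R) divff ?pnatr_eq0// c1; congr f; apply: val_inj.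
  by apply/rowP => i; rewrite /= mxE ord1 se.
rewrite addNr mul0r c0; congr f; apply: val_inj.
by apply/rowP => i; rewrite /= mxE ord1 se.
Qed.

End PathConnected.

(** * Realizing the prescribed invariants *)

Lemma hub_Lovasz_bound (R : realType) (H : sgraph) (x y z : H) :
  adj y x -> adj y z -> x != z -> is_Lovasz_bound R (hub_graph H) 3%Z.
Proof.
move=> yx yz xz; exists 0 => //.
have down := @neighborhood_complex_down (hub_graph H).
have Kspoke u : [set hub H; old u]%SET \in neighborhood_complex (hub_graph H).
  by apply: (@common_neighbor (hub_graph H) _ _ (spoke u)) => /=.
have Kxz : [set old x; old z]%SET \in neighborhood_complex (hub_graph H).
  exact: (@common_neighbor (hub_graph H) _ _ (old y)).
split.
  apply: (@realization_0_connected _ _ _ down (hub H)).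
    by apply: down (Kspoke x); rewrite finset.sub1set !inE eqxx.
  by move=> v _; exact: hub_connect yx v.
move=> k kconn; rewrite leNgt; apply/negP => k0.
have hx : hub H != old x by [].
have xz' : old x != old z by apply: contraNneq xz => -[->].
have zh : old z != hub H by [].
have Kz : [set old z; hub H]%SET \in neighborhood_complex (hub_graph H).
  by rewrite finset.setUC.
have [g [gc gf]] := kconn 2 (k0 : 2%:Z - 1 <= k) _
  (@triangle_loop_continuous R _ _ _ _ _ hx xz' zh down (Kspoke x) Kxz Kz).
exact: (triangle_loop_not_null (@hub_facet H x) gc gf).
Qed.

(* The hypothesis 2 < q excludes only p = q = 2, where no such graph exists:
   the Lovasz bound 3 would have to be at most the chromatic number 2. *)
Theorem corollary1 (R : realType) (l m p q : nat)
    (hl : (0 < l)%N) (hm : (0 < m)%N)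
    (hp : (2 <= p)%N) (hpq : (p <= q)%N) (hq : (2 < q)%N) :
  exists G : sgraph,
    [/\ contains_copy G (Kbip l m),
        chromatic_number G = q,
        clique_number G = p &
        is_Lovasz_bound R G 3%Z].
Proof.
pose S := shift_graph (@subset_rank q).
pose B := Kbip l.+1 m.
pose H := disjoint_union (disjoint_union S (complete_graph p)) B.
exists (hub_graph H); split.
- exists (fun u => old (inr match u with
    inl i => inl (widen_ord (leqnSn l) i) | inr j => inr j end : H)); split.
    move=> [i|i] [j|j] [] //; last by move=> ->.
    by move=> ij; congr inl; apply: val_inj.
  by move=> [i|i] [j|j].
- apply: chromatic_numberE.
    apply: colorable_hub => //; apply: colorable_disjoint_union.
      apply: colorable_disjoint_union; first exact: colorable_subset_shift.
      exact: colorable_complete.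
    by apply: colorable_Kbip; exact: ltnW.
  move=> k Gk; apply: subset_shift_colors.
  exact: (@colorable_hom _ S (fun s => old (inl (inl s) : H))) Gk.
- pose K : {set hub_graph H} :=
    [set old (inl (inr i) : H) | i in [set: complete_graph p]]%SET.
  apply: (@clique_numberE _ K).
  + apply/cliqueP => _ _ /imsetP[i _ ->] /imsetP[j _ ->].
    by apply: contraNneq => ->.
  + by rewrite card_imset ?cardsT ?card_ord// => i j [].
  + apply: clique_hub => //; apply: clique_disjoint_union => [|A cA].
      apply: clique_disjoint_union => [A cA|A _].
        exact: leq_trans (clique_shift cA) hp.
      by rewrite -[leqRHS]card_ord max_card.
    exact: leq_trans (clique_Kbip cA) hp.
- apply: (@hub_Lovasz_bound R H (inr (inl ord0)) (inr (inr (Ordinal hm)))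
    (inr (inl ord_max))) => //.
  by apply/eqP => -[] l_eq0; rewrite -l_eq0 in hl.
Qed.
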